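(* Let $\mathbb{V}_7=(\mathbb{R}^7,\veebar_7)$ be the exceptional Vidinli algebra. Then: (i) $\mathbb{V}_7$ is non-commutative and non-associative, with two-sided identity $e_1$; (ii) every non-zero element $a\in\mathbb{V}_7$ is two-sided invertible with $a^{-1}=\bar a/\|a\|^2$, i.e. $a\veebar_7(\bar a/\|a\|^2)=(\bar a/\|a\|^2)\veebar_7 a=e_1$; (iii) $\mathbb{V}_7$ has no proper non-zero two-sided ideals, and no non-zero idempotent except $e_1$; (iv) the group $\mathrm{Aut}(\mathbb{V}_7)$ of $\mathbb{R}$-algebra automorphisms of $\mathbb{V}_7$ is isomorphic to the unitary group $U(3)$.
   Context: Let $\{e_1,\dots,e_7\}$ be the standard orthonormal basis of $\mathbb{R}^7$ with Euclidean inner product $\langle\cdot,\cdot\rangle$, dual basis $\omega^1,\dots,\omega^7$, and $\omega^{ijk}=\omega^i\wedge\omega^j\wedge\omega^k$. Let $$\Phi=\omega^{123}+\omega^{145}+\omega^{167}+\omega^{246}-\omega^{257}-\omega^{347}-\omega^{356},$$ and let $\times:\mathbb{R}^7\times\mathbb{R}^7\to\mathbb{R}^7$ be the bilinear cross product characterized by $\langle u\times v,w\rangle=\Phi(u,v,w)$ for all $u,v,w$. The exceptional Vidinli algebra $\mathbb{V}_7=(\mathbb{R}^7,\veebar_7)$ has the bilinear product $$a\veebar_7 b=\langle a,e_1\rangle b+\langle b,e_1\rangle a-\langle a,b\rangle e_1+\langle e_1,a\times b\rangle e_1 .$$ The conjugate of $a$ is $\bar a=2\langle a,e_1\rangle e_1-a$.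 *)

(* Defs.v *)
From HB Require Import structures.
From mathcomp Require Import all_boot all_order all_algebra.
From mathcomp Require Import boolp reals.
From mathcomp Require Import complex ring.
Set Implicit Arguments.
Unset Strict Implicit.
Unset Printing Implicit Defensive.
Import Order.TTheory GRing.Theory Num.Theory.
Local Open Scope ring_scope.
Local Open Scope sesquilinear_scope.

Section Algebras.
Variables (K : fieldType) (V : vectType K) (mul : V -> V -> V).

Definition two_sided_ideal (I : {vspace V}) : Prop :=
  forall a x : V, x \in I -> mul a x \in I /\ mul x a \in I.

Definition alg_automorphism (f : 'End(V)) : Prop :=
  bijective f /\ {morph f : a b / mul a b}.

Record AlgAut := MkAlgAut {
  aut_fun :> 'End(V);
  _ : `[< alg_automorphism aut_fun >] }.

HB.instance Definition _ := [isSub for aut_fun].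
HB.instance Definition _ := [Choice of AlgAut by <:].

Lemma autP (f : AlgAut) : alg_automorphism f.
Proof. exact/asboolP/(valP f). Qed.

Lemma aut_one_subproof : `[< alg_automorphism \1%VF >].
Proof.
apply/asboolP; split=> [|a b]; last by rewrite !id_lfunE.
by exists id => x; rewrite id_lfunE.
Qed.

Lemma aut_mul_subproof (f g : AlgAut) : `[< alg_automorphism (f \o g)%VF >].
Proof.
apply/asboolP; have [bf mf] := autP f; have [bg mg] := autP g.
split=> [|a b]; last by rewrite !lfunE /= mg mf.
by apply: (eq_bij (bij_comp bf bg)) => x; rewrite lfunE.
Qed.

Lemma aut_ker (f : AlgAut) : lker f == 0%VS.
Proof. by apply/lker0P; have [/bij_inj] := autP f. Qed.

Lemma aut_inv_subproof (f : AlgAut) : `[< alg_automorphism (f^-1)%VF >].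
Proof.
have kf := aut_ker f; have [bf mf] := autP f.
have fK : cancel f (f^-1)%VF := lker0_lfunK kf.
have fVK : cancel (f^-1)%VF f by apply/(bij_can_sym bf).
apply/asboolP; split; first by exists f.
by move=> a b; apply: (bij_inj bf); rewrite mf !fVK.
Qed.

Definition aut_one : AlgAut := MkAlgAut aut_one_subproof.
Definition aut_mul (f g : AlgAut) : AlgAut := MkAlgAut (aut_mul_subproof f g).
Definition aut_inv (f : AlgAut) : AlgAut := MkAlgAut (aut_inv_subproof f).

Lemma aut_mulA : associative aut_mul.
Proof. by move=> f g h; apply: val_inj; rewrite /= comp_lfunA. Qed.
Lemma aut_1mul : left_id aut_one aut_mul.
Proof. by move=> f; apply: val_inj; rewrite /= comp_lfun1l. Qed.
Lemma aut_mul1 : right_id aut_one aut_mul.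
Proof. by move=> f; apply: val_inj; rewrite /= comp_lfun1r. Qed.
Lemma aut_Vmul : left_inverse aut_one aut_inv aut_mul.
Proof. by move=> f; apply: val_inj; rewrite /= lker0_compVf // aut_ker. Qed.
Lemma aut_mulV : right_inverse aut_one aut_inv aut_mul.
Proof. by move=> f; apply: val_inj; rewrite /= lker0_compfV // aut_ker. Qed.

HB.instance Definition _ :=
  isGroup.Build AlgAut aut_mulA aut_1mul aut_mul1 aut_Vmul aut_mulV.

End Algebras.

Section UnitaryGroup.
Variables (C : numClosedFieldType) (n : nat).

Record Unitary := MkUnitary { U_mx :> 'M[C]_n; _ : U_mx \is unitarymx }.

HB.instance Definition _ := [isSub for U_mx].
HB.instance Definition _ := [Choice of Unitary by <:].

Lemma U_one_subproof : (1%:M : 'M[C]_n) \is unitarymx.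
Proof. by apply/unitarymxP; rewrite mul1mx trmx1 map_mx1. Qed.
Lemma U_mul_subproof (A B : Unitary) : (A *m B : 'M[C]_n) \is unitarymx.
Proof. exact: mul_unitarymx (valP A) (valP B). Qed.
Lemma U_inv_subproof (A : Unitary) : ((A : 'M[C]_n)^t*) \is unitarymx.
Proof. by rewrite trmxC_unitary (valP A). Qed.

Definition U_one : Unitary := MkUnitary U_one_subproof.
Definition U_mul (A B : Unitary) : Unitary := MkUnitary (U_mul_subproof A B).
Definition U_inv (A : Unitary) : Unitary := MkUnitary (U_inv_subproof A).

Lemma U_mulA : associative U_mul.
Proof. by move=> A B D; apply: val_inj; rewrite /= mulmxA. Qed.
Lemma U_1mul : left_id U_one U_mul.
Proof. by move=> A; apply: val_inj; rewrite /= mul1mx. Qed.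
Lemma U_mul1 : right_id U_one U_mul.
Proof. by move=> A; apply: val_inj; rewrite /= mulmx1. Qed.
Lemma U_mulV : right_inverse U_one U_inv U_mul.
Proof. by move=> A; apply: val_inj; apply/unitarymxP/(valP A). Qed.
Lemma U_Vmul : left_inverse U_one U_inv U_mul.
Proof.
by move=> A; apply: val_inj; apply: mulmx1C; apply/unitarymxP/(valP A).
Qed.

HB.instance Definition _ := isGroup.Build Unitary U_mulA U_1mul U_mul1 U_Vmul U_mulV.

End UnitaryGroup.

Definition group_isomorphic (G H : groupType) : Prop :=
  exists f : {multiplicative G -> H}, bijective f.

Section Vidinli.
Variable R : realType.
Local Notation V7 := 'rV[R]_7.
Implicit Types a b c u v w : V7.

(* The indices i, j, k of e, omega and omega3 run over 1, ..., 7. *)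
Definition e (i : nat) : V7 := delta_mx 0 (inord i.-1).
Definition omega (i : nat) (u : V7) : R := u 0 (inord i.-1).

Definition dot (u v : V7) : R := \sum_i u 0 i * v 0 i.
Definition vnorm (u : V7) : R := Num.sqrt (dot u u).

(* The wedge product is normalized so that omega^{ijk}(e_i, e_j, e_k) = 1. *)
Definition omega3 (i j k : nat) (u v w : V7) : R :=
  \det (\matrix_(p < 3, q < 3)
    omega (nth 0%N [:: i; j; k] q) (nth 0 [:: u; v; w] p)).

Definition Phi (u v w : V7) : R :=
  omega3 1 2 3 u v w + omega3 1 4 5 u v w + omega3 1 6 7 u v w
  + omega3 2 4 6 u v w - omega3 2 5 7 u v w - omega3 3 4 7 u v w
  - omega3 3 5 6 u v w.

(* The vector characterized by <cross u v, w> = Phi u v w; see crossP and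
   cross_unique. *)
Definition cross (u v : V7) : V7 := \row_i Phi u v (delta_mx 0 i).

Definition vmul (a b : V7) : V7 :=
  dot a (e 1) *: b + dot b (e 1) *: a - dot a b *: e 1
  + dot (e 1) (cross a b) *: e 1.

Definition vconj (a : V7) : V7 := (2 * dot a (e 1)) *: e 1 - a.

Lemma omega3E i j k u v w : omega3 i j k u v w =
  omega i u * (omega j v * omega k w - omega k v * omega j w)
  - omega j u * (omega i v * omega k w - omega k v * omega i w)
  + omega k u * (omega i v * omega j w - omega j v * omega i w).
Proof.
rewrite /omega3 (expand_det_row _ ord0) !big_ord_recl big_ord0 /cofactor !mxE /=.
rewrite !(expand_det_row _ ord0) !big_ord_recl !big_ord0 /cofactor.
rewrite !det_mx11 !mxE /=.
by rewrite /bump /=; ring.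
Qed.

Lemma Phi_linear u v : linear_for *%R (Phi u v).
Proof.
move=> x w1 w2; rewrite /Phi !omega3E /omega !mxE; ring.
Qed.

Lemma crossP u v w : dot (cross u v) w = Phi u v w.
Proof.
pose f := GRing.isLinear.Build _ _ _ _ (Phi u v) (Phi_linear u v).
pose F : {linear V7 -> R | *%R} := HB.pack (Phi u v) f.
rewrite {2}(row_sum_delta w) -[RHS]/(F _) linear_sum.
by apply: eq_bigr => i _; rewrite linearZ mxE mulrC.
Qed.

Lemma cross_unique u v c : (forall w, dot c w = Phi u v w) -> c = cross u v.
Proof.
move=> cP; apply/rowP => i; rewrite mxE -cP /dot (bigD1 i) //= big1 => [|j ji].
  by rewrite addr0 mxE !eqxx mulr1.
by rewrite mxE (negbTE ji) andbF mulr0.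
Qed.

End Vidinli.

Arguments e {R} i.

(* Main.v *)
From HB Require Import structures.
Require Import Defs.
From mathcomp Require Import all_boot all_order all_algebra.
From mathcomp Require Import boolp reals complex ring lra.
Import Order.TTheory GRing.Theory Num.Theory.
Local Open Scope ring_scope.

(** The form Phi(e_1, ., .) is omega^{23} + omega^{45} + omega^{67}, so the
    product only sees the vector e_1, the Euclidean metric and the standard
    symplectic form on the orthogonal complement of e_1.  Reading that
    complement as C^3 through z = (a_2 + i a_3, a_4 + i a_5, a_6 + i a_7) turns
    metric and symplectic form into the real part and minus the imaginary part
    of the Hermitian form h(z, w) = sum_k z_k conj(w_k), and the algebra becomes
    R + C^3 with
      (s, z) (t, w) = (s t - Re h(z, w) - Im h(z, w), s w + t z)
    ([omega1_vmul], [toC_vmul]).  Parts (i) - (iii) are read off this formula: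
    h(z, z) is a nonnegative real, whence a times its conjugate is the squared
    norm of a; an ideal with a nonzero element contains an inverse times that
    element, that is e_1; and an idempotent (s, z) satisfies (2 s - 1) z = 0 and
    s^2 - h(z, z) = s, where 2 s = 1 would force h(z, z) = -1/4.

    For the automorphism group, a unitary matrix acts on the factor C^3 and
    preserves h, hence the product ([unitary_actM]).  Conversely, an
    automorphism f fixes the identity e_1, and it preserves the complement of
    e_1 because that is the set of a whose square is a nonpositive multiple of
    e_1 ([aut_omega1_imag]).  On the complement the product is
    -(Re h + Im h) e_1, whose symmetric and antisymmetric parts in the two
    arguments recover Re h and Im h, so f preserves h ([aut_herm]).  A map of
    C^n that preserves h is multiplication by a unitary matrix, even without
    assuming additivity ([herm_isometry]); so C-linearity of f on the complement
    comes for free. *)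

(** * The standard Hermitian form on row vectors *)

Section HermitianForm.
Local Open Scope sesquilinear_scope.
Context {C : numClosedFieldType} {n : nat}.
Implicit Types (z w : 'rV[C]_n) (A : 'M[C]_n).

Definition herm z w : C := (z *m w^t*) 0 0.

Lemma hermE z w : herm z w = \sum_k z 0 k * (w 0 k)^*.
Proof. by rewrite /herm mxE; apply: eq_bigr => k _; rewrite !mxE. Qed.

Lemma hermC z w : herm w z = (herm z w)^*.
Proof.
rewrite !hermE rmorph_sum /=; apply: eq_bigr => k _.
by rewrite rmorphM /= conjCK mulrC.
Qed.

Lemma herm0r z : herm z 0 = 0.
Proof. by rewrite /herm trmx0 map_mx0 mulmx0 mxE. Qed.

Lemma hermZl (c : C) z w : herm (c *: z) w = c * herm z w.
Proof. by rewrite /herm -scalemxAl mxE. Qed.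

Lemma hermZr (c : C) z w : herm z (c *: w) = c^* * herm z w.
Proof. by rewrite hermC hermZl rmorphM /= -hermC. Qed.

Lemma herm0l z : herm 0 z = 0.
Proof. by rewrite /herm mul0mx mxE. Qed.

Lemma herm_ge0 z : 0 <= herm z z.
Proof. by rewrite hermE sumr_ge0 // => k _; rewrite mul_conjC_ge0. Qed.

Lemma herm_unitary A z w :
  A \is unitarymx -> herm (z *m A) (w *m A) = herm z w.
Proof.
move/unitarymxP => AA; rewrite /herm trmx_mul map_mxM mulmxA.
by rewrite -(mulmxA z) AA mulmx1.
Qed.

(** Let M have the images of the standard basis as rows.  Then F z *m M^t* lists
    the products of F z with these rows, which are the coordinates of z.  For z
    in the basis this says that M is unitary, and multiplying by M then gives
    F z = z *m M. *)
Lemma herm_isometry (F : 'rV[C]_n -> 'rV[C]_n) :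
    (forall z w, herm (F z) (F w) = herm z w) ->
  let M := \matrix_k F (delta_mx 0 k) in
  M \is unitarymx /\ forall z, F z = z *m M.
Proof.
move=> Fh M.
have MV z : F z *m M^t* = z.
  apply/rowP => k; have -> : (F z *m M^t*) 0 k = herm (F z) (F (delta_mx 0 k)).
    by rewrite hermE mxE; apply: eq_bigr => j _; rewrite !mxE.
  rewrite Fh hermE (bigD1 k) //= big1 ?addr0 => [|j jk].
    by rewrite mxE !eqxx conjC1 mulr1.
  by rewrite mxE (negbTE jk) andbF conjC0 mulr0.
have MM : M *m M^t* = 1%:M.
  by apply/row_matrixP => k; rewrite row_mul rowK MV row1.
split=> [|z]; first exact/unitarymxP.
by rewrite -[F z]mulmx1 -(mulmx1C MM) mulmxA MV.
Qed.

End HermitianForm.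

(** * The splitting of the algebra as R + C^3 *)

Section Vidinli.
Variable R : realType.
Local Notation V7 := 'rV[R]_7.
Local Notation C := R[i].
Implicit Types (a b u v : V7) (z w : 'rV[C]_3).

Definition toC a : 'rV[C]_3 :=
  \row_(k < 3) Complex (omega k.*2.+2 a) (omega k.*2.+3 a).

Definition ofC z : V7 :=
  \row_i [:: 0; complex.Re (z 0 0); complex.Im (z 0 0);
             complex.Re (z 0 1); complex.Im (z 0 1);
             complex.Re (z 0 2); complex.Im (z 0 2)]`_i.

Lemma omegaD i a b : omega i (a + b) = omega i a + omega i b.
Proof. by rewrite /omega mxE. Qed.

Lemma omegaZ i (c : R) a : omega i (c *: a) = c * omega i a.
Proof. by rewrite /omega mxE. Qed.

Lemma omegaN i a : omega i (- a) = - omega i a.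
Proof. by rewrite /omega mxE. Qed.

Lemma omega_e1 i : (i < 7)%N -> omega i.+1 (e 1 : V7) = (i == 0%N)%:R.
Proof. by move=> i7; rewrite /omega mxE eqxx /= -val_eqE /= !inordK. Qed.

Lemma dotE a b : dot a b = \sum_(i < 7) omega i.+1 a * omega i.+1 b.
Proof. by apply: eq_bigr => i _; rewrite /omega /= inord_val. Qed.

Lemma dot_e1 a : dot a (e 1) = omega 1 a.
Proof.
rewrite dotE (bigD1 ord0) //= omega_e1 // mulr1 big1 ?addr0 // => -[i i7].
rewrite -val_eqE /= => /negbTE i0.
by rewrite omega_e1 // i0 mulr0.
Qed.

Lemma toCD a b : toC (a + b) = toC a + toC b.
Proof. by apply/rowP => k; rewrite !mxE !omegaD. Qed.

Lemma toCZ (c : R) a : toC (c *: a) = (c%:C)%C *: toC a.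
Proof.
apply/rowP => k; rewrite !mxE !omegaZ; apply/eqP.
by rewrite eq_complex /= !mul0r subr0 addr0 !eqxx.
Qed.

Lemma toC_e1 : toC (e 1) = 0.
Proof.
by apply/rowP => -[[|[|[|//]]] k3]; rewrite !mxE !omega_e1.
Qed.

Lemma V7_ext a b : omega 1 a = omega 1 b -> toC a = toC b -> a = b.
Proof.
move=> ab1 abC; apply/rowP => i.
suff: omega i.+1 a = omega i.+1 b by rewrite /omega /= inord_val.
have ab (k : 'I_3) : omega k.*2.+2 a = omega k.*2.+2 b /\
                     omega k.*2.+3 a = omega k.*2.+3 b.
  by have /rowP/(_ k) := abC; rewrite !mxE => -[-> ->].
case: i => -[|[|[|[|[|[|[|//]]]]]]] _ //=;
  by [have [] := ab 0 | have [] := ab 1 | have [] := ab 2].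
Qed.

Lemma omega1_ofC z : omega 1 (ofC z) = 0.
Proof. by rewrite /omega mxE inordK. Qed.

Lemma ofCK z : toC (ofC z) = z.
Proof.
apply/rowP => -[[|[|[|//]]] k3]; rewrite !mxE /omega !mxE !inordK //=.
- by rewrite [in RHS](_ : Ordinal k3 = 0); [case: (z _ _) | exact: val_inj].
- by rewrite [in RHS](_ : Ordinal k3 = 1); [case: (z _ _) | exact: val_inj].
- by rewrite [in RHS](_ : Ordinal k3 = 2); [case: (z _ _) | exact: val_inj].
Qed.

Lemma V7_split a : a = omega 1 a *: e 1 + ofC (toC a).
Proof.
apply: V7_ext.
  by rewrite omegaD omegaZ omega_e1 // omega1_ofC mulr1 addr0.
by rewrite toCD toCZ toC_e1 scaler0 add0r ofCK.
Qed.

Local Notation h := (fun a b => herm (toC a) (toC b)).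

Lemma dot_herm a b :
  dot a b = omega 1 a * omega 1 b + complex.Re (h a b).
Proof.
rewrite dotE /= hermE !big_ord_recl !big_ord0 !mxE /=.
by rewrite /bump /=; ring.
Qed.

(** The Euclidean product on the complement of e_1 is Re h, and
    Phi(e_1, a, b) is -Im h(a, b). *)
Lemma omega1_vmul a b : omega 1 (vmul a b) =
  omega 1 a * omega 1 b - (complex.Re (h a b) + complex.Im (h a b)).
Proof.
rewrite /vmul !(omegaD, omegaN, omegaZ) omega_e1 // !dot_e1 dot_herm.
rewrite [dot (e 1) _](_ : _ = dot (cross a b) (e 1)); last first.
  by apply: eq_bigr => i _; rewrite mulrC.
rewrite crossP /Phi !omega3E !omega_e1 //=.
rewrite hermE !big_ord_recl !big_ord0 !mxE /=.
rewrite /bump /=; ring.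
Qed.

Lemma toC_vmul a b : toC (vmul a b) =
  ((omega 1 a)%:C)%C *: toC b + ((omega 1 b)%:C)%C *: toC a.
Proof.
by rewrite /vmul -!scaleNr !(toCD, toCZ) toC_e1 !scaler0 !addr0 !dot_e1.
Qed.

(** * Identity, inverses, ideals and idempotents *)

Lemma vmul1l : left_id (e 1) (@vmul R).
Proof.
move=> a; apply: V7_ext.
  by rewrite omega1_vmul toC_e1 herm0l omega_e1 //= mul1r addr0 subr0.
by rewrite toC_vmul toC_e1 scaler0 addr0 omega_e1 // scale1r.
Qed.

Lemma vmul1r : right_id (e 1) (@vmul R).
Proof.
move=> a; apply: V7_ext.
  by rewrite omega1_vmul toC_e1 herm0r omega_e1 //= mulr1 addr0 subr0.
by rewrite toC_vmul toC_e1 scaler0 add0r omega_e1 // scale1r.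
Qed.

Lemma ReMreal (c : R) (x : C) : complex.Re ((c%:C)%C * x) = c * complex.Re x.
Proof. by case: x => x y /=; rewrite mul0r subr0. Qed.

Lemma ImMreal (c : R) (x : C) : complex.Im ((c%:C)%C * x) = c * complex.Im x.
Proof. by case: x => x y /=; rewrite mul0r addr0. Qed.

Lemma vmulZl (c : R) a b : vmul (c *: a) b = c *: vmul a b.
Proof.
apply: V7_ext.
  rewrite !(omegaZ, omega1_vmul) toCZ hermZl ReMreal ImMreal; ring.
rewrite !(toCZ, toC_vmul) omegaZ scalerDr rmorphM !scalerA.
by congr (_ + _ *: _); rewrite mulrC.
Qed.

Lemma conjC_real (c : R) : ((c%:C)%C)^* = (c%:C)%C.
Proof. exact: conjc_real. Qed.

Lemma vmulZr (c : R) a b : vmul a (c *: b) = c *: vmul a b.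
Proof.
apply: V7_ext.
  rewrite !(omegaZ, omega1_vmul) toCZ hermZr conjC_real ReMreal ImMreal; ring.
rewrite !(toCZ, toC_vmul) omegaZ scalerDr rmorphM !scalerA.
by congr (_ *: _ + _); rewrite mulrC.
Qed.

(** Products of vectors orthogonal to e_1 are multiples of e_1 that determine h:
    exchanging a and b changes only the sign of the imaginary part. *)
Lemma vmul_imag a b : omega 1 a = 0 -> omega 1 b = 0 ->
  vmul a b = - (complex.Re (h a b) + complex.Im (h a b)) *: e 1.
Proof.
move=> a0 b0; apply: V7_ext.
  by rewrite omega1_vmul a0 b0 mulr0 sub0r omegaZ omega_e1 // mulr1.
by rewrite toC_vmul toCZ toC_e1 scaler0 a0 b0 !scale0r addr0.
Qed.

Lemma Im_herm z : complex.Im (herm z z) = 0.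
Proof. by have := herm_ge0 z; rewrite lecE => /andP[/eqP]. Qed.

Lemma Re_herm_ge0 z : 0 <= complex.Re (herm z z).
Proof. by have := herm_ge0 z; rewrite lecE => /andP[_]. Qed.

Lemma dot_ge0 a : 0 <= dot a a.
Proof. by rewrite dotE sumr_ge0 // => i _; rewrite -expr2 sqr_ge0. Qed.

Lemma dot_eq0 a : dot a a = 0 -> a = 0.
Proof.
move/psumr_eq0P => a0; apply/rowP => i; rewrite mxE; apply/eqP.
by rewrite -sqrf_eq0 expr2 a0 // => j _; rewrite -expr2 sqr_ge0.
Qed.

Lemma sqr_vnorm a : vnorm a ^+ 2 = dot a a.
Proof. exact/sqr_sqrtr/dot_ge0. Qed.

Lemma omega1_vconj a : omega 1 (vconj a) = omega 1 a.
Proof. rewrite /vconj dot_e1 !(omegaD, omegaN, omegaZ) omega_e1 //=; ring. Qed.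

Lemma toC_vconj a : toC (vconj a) = - toC a.
Proof.
rewrite /vconj -scaleN1r toCD !toCZ toC_e1 scaler0 add0r rmorphN1.
by rewrite scaleN1r.
Qed.

Lemma vmul_vconjr a : vmul a (vconj a) = dot a a *: e 1.
Proof.
apply: V7_ext.
  rewrite omega1_vmul omega1_vconj toC_vconj -scaleN1r hermZr rmorphN1 mulN1r.
  rewrite omegaZ omega_e1 // dot_herm; have := Im_herm (toC a).
  case: (herm _ _) => x y /= ->; ring.
by rewrite toC_vmul omega1_vconj toC_vconj scalerN addNr toCZ toC_e1 scaler0.
Qed.

Lemma vmul_vconjl a : vmul (vconj a) a = dot a a *: e 1.
Proof.
apply: V7_ext.
  rewrite omega1_vmul omega1_vconj toC_vconj -scaleN1r hermZl mulN1r.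
  rewrite omegaZ omega_e1 // dot_herm; have := Im_herm (toC a).
  case: (herm _ _) => x y /= ->; ring.
by rewrite toC_vmul omega1_vconj toC_vconj scalerN subrr toCZ toC_e1 scaler0.
Qed.

Lemma vmul_inverse a : a != 0 ->
  vmul a ((vnorm a ^+ 2)^-1 *: vconj a) = e 1 /\
  vmul ((vnorm a ^+ 2)^-1 *: vconj a) a = e 1.
Proof.
move=> /eqP a0; have N0 : dot a a != 0 by apply/eqP => /dot_eq0.
rewrite sqr_vnorm vmulZr vmulZl vmul_vconjr vmul_vconjl scalerA mulVf //.
by rewrite scale1r.
Qed.

Lemma vmul_simple (I : {vspace V7}) :
  two_sided_ideal (@vmul R) I -> I = 0%VS \/ I = fullv.
Proof.
move=> idI; have [->|I0] := eqVneq I 0%VS; [by left | right].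
have a0 : vpick I != 0 by rewrite vpick0.
have [_ {a0}aV] := vmul_inverse _ a0.
have e1I : e 1 \in I by rewrite -aV; apply: (idI _ _ (memv_pick I)).1.
apply/vspaceP => b; rewrite memvf -(vmul1r b).
by have [] := idI b _ e1I.
Qed.

Lemma e1_neq0 : (e 1 : V7) != 0.
Proof.
apply/eqP => /(congr1 (omega 1)); rewrite omega_e1 // /omega mxE => /eqP.
by rewrite oner_eq0.
Qed.

Lemma vmul_idempotent a : a != 0 -> vmul a a = a -> a = e 1.
Proof.
move=> a0 aa.
have := congr1 toC aa; rewrite toC_vmul -scalerDl -rmorphD /= => /eqP.
rewrite -subr_eq0 -[X in _ - X]scale1r -scalerBl scaler_eq0.
have := congr1 (omega 1) aa; rewrite omega1_vmul Im_herm.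
have := Re_herm_ge0 (toC a); set t := omega 1 a => N0 Ea.
case/orP => [|/eqP z0].
  rewrite eq_complex /= => /andP[/eqP t2 _]; exfalso.
  by move: (complex.Re _) N0 Ea t2 {a0 aa} => N N0 Ea t2; nra.
have tE : t * (t - 1) = 0.
  by move: Ea; rewrite z0 herm0l /=; lra.
have aE : a = t *: e 1.
  by apply: V7_ext; rewrite ?omegaZ ?omega_e1 ?mulr1 // z0 toCZ toC_e1 scaler0.
move/eqP: tE; rewrite mulf_eq0 subr_eq0 => /orP[]/eqP tE.
  by move: a0; rewrite aE tE scale0r eqxx.
by rewrite aE tE scale1r.
Qed.

(** u = e_2 and v = e_3 multiply to e_1 in one order and to - e_1 in the other,
    which refutes commutativity directly and associativity on the triple
    u, v, u. *)
Let u : V7 := ofC (delta_mx 0 0).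
Let v : V7 := ofC (('i)%C *: delta_mx 0 0).

Lemma herm_delta : herm (delta_mx 0 0 : 'rV[C]_3) (delta_mx 0 0) = 1.
Proof.
rewrite hermE !big_ord_recl big_ord0 !mxE /=.
by rewrite conjC0 conjC1 mulr1 !mulr0 !addr0.
Qed.

Lemma vmul_uv : vmul u v = e 1.
Proof.
rewrite vmul_imag ?omega1_ofC // !ofCK hermZr herm_delta mulr1 /=.
by rewrite add0r !opprK scale1r.
Qed.

Lemma vmul_vu : vmul v u = - e 1.
Proof.
rewrite vmul_imag ?omega1_ofC // !ofCK hermZl herm_delta mulr1 /=.
by rewrite add0r scaleN1r.
Qed.

Lemma vmul_nonC : ~ commutative (@vmul R).
Proof.
move=> /(_ u v); rewrite vmul_uv vmul_vu => /eqP.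
by rewrite -addr_eq0 -mulr2n -scaler_nat scaler_eq0 pnatr_eq0 (negbTE e1_neq0).
Qed.

Lemma vmul_nonA : ~ associative (@vmul R).
Proof.
move=> /(_ u v u); rewrite vmul_uv vmul_vu vmul1l -scaleN1r vmulZr vmul1r.
rewrite scaleN1r => /esym/eqP.
rewrite -addr_eq0 -mulr2n -scaler_nat scaler_eq0 pnatr_eq0 /= => /eqP u0.
have := vmul_uv; rewrite u0 -(scale0r u) vmulZl scale0r => /esym/eqP.
by rewrite (negbTE e1_neq0).
Qed.

(** * Automorphisms *)

Local Notation Aut := (AlgAut (@vmul R)).
Implicit Types (f g : Aut) (A : Unitary C 3).

Lemma autM f : {morph f : a b / vmul a b}.
Proof. by have [] := autP f. Qed.

Lemma aut_e1 f : f (e 1) = e 1.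
Proof.
have [[g _ gK] _] := autP f.
by rewrite -[LHS]vmul1r -[X in vmul _ X]gK -autM vmul1l gK.
Qed.

(** For a orthogonal to e_1, the square of f a is the image of the square of a,
    a nonpositive multiple of e_1.  If f a had a nonzero e_1-component t, its
    C^3-component z would vanish because 2 t z = 0, and t^2 would be
    nonpositive. *)
Lemma aut_omega1_imag f a : omega 1 a = 0 -> omega 1 (f a) = 0.
Proof.
move=> a0; apply/eqP; apply: contraT => fa0.
have := autM f a a; rewrite (vmul_imag _ _ a0 a0) Im_herm addr0 linearZ /=.
rewrite aut_e1 => E.
have /esym/eqP := congr1 toC E; rewrite toC_vmul toCZ toC_e1 scaler0.
rewrite -scalerDl -rmorphD scaler_eq0 => /orP[|/eqP fz].
  by rewrite eq_complex /= eqxx andbT => /eqP ?; move/eqP: fa0; lra.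
have := congr1 (omega 1) E.
rewrite omega1_vmul omegaZ omega_e1 // mulr1 fz herm0l /= addr0 subr0.
have := Re_herm_ge0 (toC a); have : 0 < omega 1 (f a) * omega 1 (f a).
  by rewrite -expr2 exprn_even_gt0.
lra.
Qed.

(** Preservation of Re h + Im h for the pairs (a, b) and (b, a) gives that of
    Re h and Im h, as h(b, a) is the conjugate of h(a, b). *)
Lemma aut_herm f a b : omega 1 a = 0 -> omega 1 b = 0 -> h (f a) (f b) = h a b.
Proof.
have key x y : omega 1 x = 0 -> omega 1 y = 0 ->
  complex.Re (h (f x) (f y)) + complex.Im (h (f x) (f y)) =
  complex.Re (h x y) + complex.Im (h x y).
  move=> x0 y0; have := autM f x y.
  rewrite !vmul_imag ?aut_omega1_imag // linearZ /= aut_e1.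
  by move/(congr1 (omega 1)); rewrite !omegaZ omega_e1 // !mulr1 => /oppr_inj.
move=> a0 b0; have := key b a b0 a0; have := key a b a0 b0; cbv beta.
rewrite [herm (toC (f b)) _]hermC [herm (toC b) _]hermC.
case: (herm (toC (f a)) _) (herm (toC a) _) => x y [x' y'] /= E1 E2.
by apply/eqP; rewrite eq_complex /=; apply/andP; split; apply/eqP; lra.
Qed.

(** The transpose makes the matrix act on columns, so that composition of
    automorphisms corresponds to the matrix product in the same order. *)
Definition aut_mx f : 'M[C]_3 :=
  (\matrix_k toC (f (ofC (delta_mx 0 k))))^T.

Lemma aut_mx_spec f :
  aut_mx f \is unitarymx /\
  forall z, toC (f (ofC z)) = z *m (aut_mx f)^T.
Proof.
have [z w|fU fE] := @herm_isometry C 3 (fun z => toC (f (ofC z))).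
  by rewrite aut_herm ?omega1_ofC // !ofCK.
by split=> [|z]; rewrite /aut_mx ?trmx_unitary // trmxK.
Qed.

Lemma autE f a : f a = omega 1 a *: e 1 + ofC (toC a *m (aut_mx f)^T).
Proof.
rewrite {1}[a]V7_split linearD linearZ /= aut_e1; congr (_ + _).
apply: V7_ext; first by rewrite aut_omega1_imag ?omega1_ofC.
by rewrite ofCK (aut_mx_spec f).2.
Qed.

Definition aut_unitary f : Unitary C 3 := MkUnitary (aut_mx_spec f).1.

Definition unitary_act A a : V7 := omega 1 a *: e 1 + ofC (toC a *m A^T).

Lemma omega1_act A a : omega 1 (unitary_act A a) = omega 1 a.
Proof. by rewrite omegaD omegaZ omega_e1 // omega1_ofC mulr1 addr0. Qed.

Lemma toC_act A a : toC (unitary_act A a) = toC a *m A^T.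
Proof. by rewrite toCD toCZ toC_e1 scaler0 add0r ofCK. Qed.

Lemma unitary_act_linear A : linear (unitary_act A).
Proof.
move=> c a b; apply: V7_ext; first by rewrite !(omegaD, omegaZ, omega1_act).
by rewrite !(toCD, toCZ, toC_act) mulmxDl scalemxAl.
Qed.

HB.instance Definition _ A :=
  GRing.isLinear.Build R V7 V7 _ (unitary_act A) (unitary_act_linear A).

Lemma unitary_actM A a b :
  unitary_act A (vmul a b) = vmul (unitary_act A a) (unitary_act A b).
Proof.
have AU : A^T \is unitarymx by rewrite trmx_unitary (valP A).
apply: V7_ext; rewrite !(omega1_act, toC_act, omega1_vmul, toC_vmul).
  by rewrite herm_unitary.
by rewrite mulmxDl -!scalemxAl.
Qed.

Lemma unitary_actV A : cancel (unitary_act A) (unitary_act A^-1%g).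
Proof.
move=> a; apply: V7_ext; rewrite !(omega1_act, toC_act) //.
rewrite -mulmxA -trmx_mul.
have -> : (A^-1%g : 'M_3) *m A = 1%:M := congr1 val (mulVg A).
by rewrite trmx1 mulmx1.
Qed.

Lemma unitary_aut_subproof A :
  `[< alg_automorphism (@vmul R) (linfun (unitary_act A)) >].
Proof.
apply/asboolP; split=> [|a b]; last by rewrite !lfunE /= unitary_actM.
exists (unitary_act A^-1%g) => a; rewrite lfunE /= ?unitary_actV //.
by rewrite -{1}[A]invgK unitary_actV.
Qed.

Definition unitary_aut A : Aut := MkAlgAut (unitary_aut_subproof A).

Lemma aut_unitaryK : cancel aut_unitary unitary_aut.
Proof. by move=> f; apply/val_inj/lfunP => a; rewrite lfunE /= autE. Qed.

Lemma mulmx_trmx_inj (M N : 'M[C]_3) : (forall z, z *m M^T = z *m N^T) -> M = N.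
Proof.
move=> MN; apply/trmx_inj/row_matrixP => k.
by rewrite !rowE MN.
Qed.

Lemma unitary_autK : cancel unitary_aut aut_unitary.
Proof.
move=> A; apply/val_inj/mulmx_trmx_inj => z /=.
by rewrite -(aut_mx_spec _).2 lfunE /= toC_act ofCK.
Qed.

Lemma aut_unitaryM : {morph aut_unitary : f g / (f * g)%g}.
Proof.
move=> f g; apply/val_inj/mulmx_trmx_inj => z /=.
rewrite -(aut_mx_spec _).2 lfunE /= autE toCD toCZ toC_e1 scaler0 add0r ofCK.
by rewrite (aut_mx_spec g).2 trmx_mul mulmxA.
Qed.

HB.instance Definition _ :=
  isMultiplicative.Build Aut (Unitary C 3) aut_unitary aut_unitaryM.

Lemma aut_vmul_iso : group_isomorphic Aut (Unitary C 3).
Proof.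
exists aut_unitary.
exact: Bijective aut_unitaryK unitary_autK.
Qed.

End Vidinli.

Theorem theorem3p4 (R : realType) :
  [/\ ~ commutative (@vmul R), ~ associative (@vmul R),
      left_id (e 1) (@vmul R) & right_id (e 1) (@vmul R)]
  /\
  (forall a : 'rV[R]_7, a != 0 ->
     vmul a ((vnorm a ^+ 2)^-1 *: vconj a) = e 1 /\
     vmul ((vnorm a ^+ 2)^-1 *: vconj a) a = e 1)
  /\
  (forall I : {vspace 'rV[R]_7},
     two_sided_ideal (@vmul R) I -> I = 0%VS \/ I = fullv)
  /\
  (forall a : 'rV[R]_7, a != 0 -> vmul a a = a -> a = e 1)
  /\
  group_isomorphic (AlgAut (@vmul R)) (Unitary R[i] 3).
Proof.
split; first exact: And4 (@vmul_nonC R) (@vmul_nonA R) (@vmul1l R) (@vmul1r R).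
split; first exact: vmul_inverse.
split; first exact: vmul_simple.
split; first exact: vmul_idempotent.
exact: aut_vmul_iso.
Qed.
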